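(* Let $n \ge 3$ and $m \ge 1$ be integers, let $p$ be a prime, and let $G_n^{(m)} = \mathrm{UT}_n(\mathbb{F}_{p^m})/\gamma_3(\mathrm{UT}_n(\mathbb{F}_{p^m}))$. Then $\mathrm{Aut}_c(G_n^{(m)})$ is an elementary abelian $p$-group of order $p^{2m^2+mn-3m}$. Moreover, the order of $\mathrm{Out}_c(G_n^{(m)})$ is $p^{2m(m-1)}$, which is independent of $n$.
   Context: $\mathbb{F}_{p^m}$ is the field with $p^m$ elements. $\mathrm{UT}_n(K)$ is the group of all $n\times n$ lower unitriangular matrices (ones on the diagonal, zeros above it) with entries in $K$. For a group $G$, the lower central series is defined by $\gamma_1(G)=G$ and $\gamma_{j+1}(G)=[\gamma_j(G),G]$ for $j\ge 1$. An automorphism $\alpha$ of $G$ is class preserving if $\alpha(x)$ is conjugate to $x$ in $G$ for every $x\in G$; $\mathrm{Aut}_c(G)$ is the group of all class preserving automorphisms of $G$, $\mathrm{Inn}(G)$ is its normal subgroup of inner automorphisms, and $\mathrm{Out}_c(G) = \mathrm{Aut}_c(G)/\mathrm{Inn}(G)$. *)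

(* Defs.v *)
From mathcomp Require Import all_boot all_order all_algebra all_fingroup all_solvable.

Set Implicit Arguments.
Unset Strict Implicit.
Unset Printing Implicit Defensive.

Import GRing.Theory.
Local Open Scope group_scope.

Section Unitriangular.

Variables (n : nat) (F : finFieldType).

(* For 0 < n, {'GL_n[F]} consists of genuine n x n matrices, its elements      *)
(* having type 'M[F]_n.-1.+1. Note that is_trig_mx means LOWER triangular.     *)
Definition UT : {set {'GL_n[F]}} :=
  [set A : {'GL_n[F]} | is_trig_mx (GLval A) & [forall i, GLval A i i == 1%R]].

Lemma UT_group_set : group_set UT.
Proof.
apply/group_setP; split.
  rewrite inE GL_1E scalar_mx_is_trig /=.
  by apply/forallP => i; rewrite mxE eqxx.
move=> A B; rewrite !inE.
case/andP=> /is_trig_mxP tA /forallP dA /andP[/is_trig_mxP tB /forallP dB].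
rewrite GL_MxE; apply/andP; split.
  apply/is_trig_mxP => i j lt_ij; rewrite mxE big1 // => k _.
  case: (ltnP i k) => [lt_ik | le_ki]; first by rewrite tA ?mul0r.
  by rewrite tB ?mulr0 // (leq_ltn_trans le_ki).
apply/forallP => i; rewrite mxE (bigD1 i) //= (eqP (dA i)) (eqP (dB i)) mulr1.
rewrite big1 ?addr0 // => k; rewrite neq_ltn => /orP[lt_ki | lt_ik].
  by rewrite tB ?mulr0.
by rewrite tA ?mul0r.
Qed.
Canonical UT_group := Group UT_group_set.

Definition UTmodL3 : {set coset_of 'L_3(UT)} := UT / 'L_3(UT).
Canonical UTmodL3_group := [group of UTmodL3].

End Unitriangular.

Section ClassPreserving.

Variables (gT : finGroupType) (G : {group gT}).

Definition Aut_c : {set {perm gT}} :=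
  [set a in Aut G | [forall x in G, a x \in x ^: G]].

Definition Inn : {set {perm gT}} := conj_aut G @* G.
Canonical Inn_group := [group of Inn].

Lemma Aut_c_group_set : group_set Aut_c.
Proof.
apply/group_setP; split.
  rewrite inE group1; apply/forall_inP => x Gx.
  by rewrite perm1 class_refl.
move=> a b; rewrite inE => /andP[Aa /forall_inP ca].
rewrite inE => /andP[Ab /forall_inP cb]; rewrite inE groupM //=.
apply/forall_inP => x Gx; rewrite permM.
have Gax: a x \in G by rewrite (Aut_closed Aa).
by rewrite -(class_eqP (ca x Gx)) cb.
Qed.
Canonical Aut_c_group := Group Aut_c_group_set.

Lemma Inn_normal : Inn <| Aut_c.
Proof.
apply/andP; split.
  apply/subsetP => _ /morphimP[g _ Gg ->].
  rewrite inE Aut_aut /=; apply/forall_inP => x Gx.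
  by rewrite conj_autE // memJ_class.
apply/subsetP => a; rewrite inE => /andP[Aa _]; rewrite inE.
apply/subsetP => _ /imsetP[_ /morphimP[g _ Gg ->] ->].
have Gag: a g \in G by rewrite (Aut_closed Aa).
suff ->: conj_aut G g ^ a = conj_aut G (a g).
  by rewrite mem_morphim // (subsetP (normG G)).
apply: (eq_Aut (A := G)); rewrite ?groupJ ?Aut_aut // => x Gx.
have Gax: a^-1 x \in G by rewrite (Aut_closed (groupVr Aa)).
rewrite conjgE !permM !conj_autE //= -(autmE Aa) morphJ //= !autmE.
by rewrite -permM mulVg perm1.
Qed.

Definition Out_c : {set coset_of Inn} := Aut_c / Inn.
Canonical Out_c_group := [group of Out_c].

End ClassPreserving.

(* Main.v *)
Require Import Defs.
From mathcomp Require Import all_boot all_order all_algebra all_fingroup all_solvable.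
From mathcomp Require Import finfield ring zify.

Set Implicit Arguments.
Unset Strict Implicit.
Unset Printing Implicit Defensive.

Import GRing.Theory.

(** Put q = p ^ m and n = r + 3.  The subgroup 'L_3(UT) consists of the
    unitriangular matrices whose first two subdiagonals vanish ([lcn_UT]), so an
    element x of the quotient G is given by the entries a_0, ..., a_(r+1) and
    b_0, ..., b_r of its first two subdiagonals ([UTmodL3_coords]), the product
    adding the a_i and satisfying
      b_i(xy) = b_i(x) + b_i(y) + a_(i+1)(x) a_i(y).
    Conjugation by g therefore fixes every a_i and adds
    a_(i+1)(x) u_i - u_(i+1) a_i(x) to b_i(x), where u_i = a_i(g) ([coord2J]).

    Let f be a class preserving automorphism.  It fixes every a_i, and
    d_i(x) = b_i(f x) - b_i(x) is additive in x.  Since d_i(x) has the above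
    form for some u depending on x, it vanishes as soon as a_i(x) and a_(i+1)(x)
    do; by additivity,
      d_i(x) = L_i(a_(i+1)(x)) + R_i(a_i(x))
    with additive self-maps L_i and R_i of F ([shift_split]).  Composing
    automorphisms adds the functions d_i, and these determine f, so that
    Aut_c(G) is elementary abelian ([Aut_c_abelem]).

    Consider now an x with a_(i+1)(x) = 0, where i < r.  Both d_i(x) and
    d_(i+1)(x) involve only the coordinate u_(i+1) of the conjugating element,
    and eliminating it gives t R_i(s) + s L_(i+1)(t) = 0 for all s and t
    ([shift_rigid]).  This forces R_i(s) = k_i s and L_(i+1)(t) = - k_i t for
    some k_i in F.  Nothing constrains the two extreme maps L_0 and R_r: for
    given x with a_1(x) nonzero, L_0 is matched by u_0 = L_0(a_1(x)) / a_1(x),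
    and R_r is matched in the same way by u_(r+1).  Hence Aut_c(G) is in
    bijection with the triples (L_0, R_r, k) made of two additive maps and of r
    scalars ([shift_data_inj], [shift_data_surj]), whose number is
      (p ^ (m ^ 2)) ^ 2 * q ^ r.
    As Inn(G) has order q ^ (r + 2), one for each value of (a_0, ..., a_(r+1))
    ([card_Inn]), dividing gives the order of Out_c(G). *)

(** * The lower central series of the unitriangular group *)

Section UnitShift.

Local Open Scope ring_scope.

(** Unipotent matrices multiply by this rule in terms of their nilpotent
    parts. *)
Lemma subr1M (R : nzRingType) (x y : R) :
  x * y - 1 = (x - 1) * (y - 1) + (x - 1) + (y - 1).
Proof. by rewrite -{1}[x](subrK 1) -{1}[y](subrK 1)
  mulrDl mulrDr mulr1 mul1r addrA addrK. Qed.

Lemma commr_subr1 (R : nzRingType) (x y : R) :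
  x * y - y * x = (x - 1) * (y - 1) - (y - 1) * (x - 1).
Proof.
rewrite -(addrKA (- 1)) (addrC (- 1)) !subr1M.
move: (x - 1) (y - 1) => a b.
by rewrite (addrAC _ a b) -[a * b + b + a]addrA -[b * a + b + a]
  addrA (addrC (b * a)) addrKA.
Qed.

End UnitShift.

Section LowerCentralSeries.

Local Open Scope ring_scope.

Variables (n : nat) (F : finFieldType).
Local Notation GL := {'GL_n.+1[F]}.
Implicit Types (D : 'M[F]_n.+1) (A B : GL) (i j : 'I_n.+1).

(** In the ring of lower triangular matrices, this is the k-th power of the
    ideal of strictly triangular ones. *)
Definition depth (k : nat) D : bool :=
  [forall i : 'I_n.+1, forall j : 'I_n.+1, (i < j + k)%N ==> (D i j == 0)].

Lemma depthP k D :
  reflect (forall i j, (i < j + k)%N -> D i j = 0) (depth k D).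
Proof.
apply: (iffP forallP) => [dD i j lt_ij | dD i].
  exact/eqP/(implyP (forallP (dD i) j)).
by apply/forallP => j; apply/implyP => lt_ij; rewrite dD.
Qed.

Lemma depthW k l D : (k <= l)%N -> depth l D -> depth k D.
Proof. by move=> le_kl /depthP dD; apply/depthP => i j ?; apply: dD; lia. Qed.

Lemma depth_zero k : depth k 0.
Proof. by apply/depthP => i j _; rewrite mxE. Qed.

Lemma depth_one : depth 0 1.
Proof. by apply/depthP => i j lt_ij;
  rewrite mxE -val_eqE /= ltn_eqF // -(addn0 j). Qed.

Lemma depthD k D1 D2 : depth k D1 -> depth k D2 -> depth k (D1 + D2).
Proof.
move=> /depthP d1 /depthP d2; apply/depthP => i j lt_ij.
by rewrite mxE d1 // d2 // addr0.
Qed.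

Lemma depthN k D : depth k D -> depth k (- D).
Proof. by move=> /depthP dD; apply/depthP => i j ?; rewrite mxE dD ?oppr0. Qed.

Lemma depthM k l D1 D2 : depth k D1 -> depth l D2 -> depth (k + l) (D1 * D2).
Proof.
move=> /depthP d1 /depthP d2; apply/depthP => i j lt_ij.
rewrite mxE big1 // => h _; have [lt_ih | le_hi] := ltnP i (h + k).
  by rewrite d1 ?mul0r.
by rewrite d2 ?mulr0 //; lia.
Qed.

(** The index is shifted so that level k is the (k + 1)-st term of the lower
    central series, level 0 being the whole unitriangular group. *)
Definition UTdepth (k : nat) : {set GL} :=
  [set A : GL | depth k.+1 (GLval A - 1)].

Lemma UTdepth_group_set k : group_set (UTdepth k).
Proof.
apply/group_setP; split=> [|A B]; first by rewrite inE GL_1E subrr depth_zero.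
rewrite !inE GL_ME subr1M => dA dB; apply: (depthD _ dB); apply: (depthD _ dA).
by apply: depthW (depthM dA dB); lia.
Qed.
Canonical UTdepth_group k := Group (UTdepth_group_set k).

Lemma UTdepthW k l A : (k <= l)%N -> A \in UTdepth l -> A \in UTdepth k.
Proof. by rewrite !inE => le_kl; apply: depthW. Qed.

Lemma UT_UTdepth0 : UT n.+1 F = UTdepth 0.
Proof.
apply/setP=> A; rewrite !inE;
  apply/andP/depthP => [[/is_trig_mxP tA /forallP dA] i j|dA].
  rewrite addn1 ltnS leq_eqVlt => /orP[/eqP/val_inj <-|lt_ij].
    by rewrite !mxE (eqP (dA i)) eqxx subrr.
  by rewrite !mxE tA // -val_eqE /= ltn_eqF // subrr.
split; last first.
  apply/forallP => i; have := dA i i;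
    rewrite addn1 ltnSn !mxE eqxx => /(_ isT)/eqP.
  by rewrite subr_eq0.
apply/is_trig_mxP => i j lt_ij;
  have /(dA i j): (i < j + 1)%N by rewrite addn1 ltnW.
by rewrite !mxE -val_eqE /= ltn_eqF // subr0.
Qed.

Lemma depth_UT A : A \in UTdepth 0 -> depth 0 (GLval A).
Proof.
by rewrite inE -{2}[GLval A](subrK 1) => dA;
  rewrite depthD ?depth_one // (depthW _ dA).
Qed.

Lemma UTdepth_entry k A i j :
  A \in UTdepth k -> (i <= j + k)%N -> GLval A i j = (i == j)%:R.
Proof.
rewrite inE => /depthP/(_ i j) + le_ij; rewrite addnS ltnS => /(_ le_ij)/eqP.
by rewrite !mxE subr_eq0 => /eqP.
Qed.

(** Writing A = 1 + X and B = 1 + Y, the commutator differs from 1 by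
    (B A)^-1 (X Y - Y X), and depth is additive on products. *)
Lemma UTdepthR k l A B :
  A \in UTdepth k -> B \in UTdepth l -> [~ A, B]%g \in UTdepth (k + l).+1.
Proof.
move=> UA UB; have U0 h C : C \in UTdepth h ->
  C \in UTdepth 0 by apply: UTdepthW.
have /depth_UT dBA: (B * A)^-1%g \in UTdepth 0 by rewrite groupV groupM ?
  (U0 _ _ UA) ?(U0 _ _ UB).
rewrite inE.
have ->: GLval [~ A, B]%g - 1 =
    GLval (B * A)^-1%g * ((GLval A - 1) * (GLval B - 1) - (GLval B - 1)
      * (GLval A - 1)).
  have ->: [~ A, B]%g = ((B * A)^-1 * (A * B))%g by rewrite commgEl conjgE
    invMg !mulgA.
  by rewrite -commr_subr1 mulrBr -!GL_ME mulVg.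
rewrite -[(k + l).+2]add0n depthM // depthD ?depthN //.
  by move: UA UB; rewrite !inE => dA dB; apply: depthW (depthM dA dB); lia.
by move: UA UB; rewrite !inE => dA dB; apply: depthW (depthM dB dA); lia.
Qed.

(** The default value 1 is never met when D has depth 1, since 1 + D is then
    invertible. *)
Definition unip D : GL := insubd (1%g : GL) (1 + D).

Lemma unipE D : depth 1 D -> GLval (unip D) = 1 + D.
Proof.
move=> /depthP dD; rewrite /unip; apply: insubdK.
rewrite -[_ \in _]/(1 + D \in unitmx) unitmxE det_trig.
  rewrite big1 ?unitr1 // => i _.
  by rewrite !mxE eqxx dD ?addr0 // addn1.
apply/is_trig_mxP => i j lt_ij.
by rewrite !mxE dD -?val_eqE /= ?ltn_eqF ?addr0 // addn1 ltnW.
Qed.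

Lemma unip_UTdepth k D : depth k.+1 D -> unip D \in UTdepth k.
Proof. by move=> dD; rewrite inE unipE ?(depthW _ dD) // addrC addKr. Qed.

Lemma depth_delta i j (t : F) k : (j + k <= i)%N -> depth k (t *: delta_mx i j).
Proof.
move=> le_ji; apply/depthP => i' j' lt_ij; rewrite !mxE.
by case: eqP => [ei|]; case: eqP => [ej|] /=; rewrite ?mulr0 //; subst; lia.
Qed.

Definition transvec i j (t : F) : GL := unip (t *: delta_mx i j).

Lemma transvecE i j t : (j < i)%N ->
  GLval (transvec i j t) = 1 + t *: delta_mx i j.
Proof. by move=> lt_ji; rewrite unipE // depth_delta // addn1. Qed.

(** Iterated, this expresses a transvection at distance i - j from the diagonal
    as a commutator of weight i - j. *)
Lemma transvecR i j (h : 'I_n.+1) t : (j < h)%N -> (h < i)%N ->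
  transvec i j t = [~ transvec i h t, transvec h j 1%R]%g.
Proof.
move=> lt_jh lt_hi; have lt_ji := ltn_trans lt_jh lt_hi.
rewrite commgEl conjgE !mulgA -[(_^-1 * _^-1)%g]invMg -mulgA.
apply: (canRL (mulKg _)); apply: val_inj.
rewrite -![\val _]/(GLval _) !GL_ME !transvecE // scale1r.
have neq_hi : (h == i) = false by rewrite -val_eqE /= ltn_eqF.
have neq_ji : (j == i) = false by rewrite -val_eqE /= ltn_eqF.
have neq_jh : (j == h) = false by rewrite -val_eqE /= ltn_eqF.
pose E a b : 'M[F]_n.+1 := delta_mx a b.
have EM a b c d : E a b * E c d = E a d *+ (b == c) by apply: mul_delta_mx_cond.
rewrite -/(E h j) -/(E i h) -/(E i j).
rewrite !(mulrDl, mulrDr, mulr1, mul1r, =^~ scalerAl, =^~ scalerAr, EM) ?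
  neq_hi ?neq_ji ?eqxx.
by rewrite /= !mulr0n mulr1n mul0r !scaler0 !addr0 !addrA; congr (_ + _);
  rewrite addrAC.
Qed.

(** Gaussian elimination: multiplying A on the right by the transvection at
    (i, j) with parameter - A i j clears the entry (i, j) and alters only the
    entries of column j lying below it.  Treating the positions column by
    column, each from top to bottom, thus reduces A to 1. *)
Lemma transvec_gen k (H : {group GL}) :
    (forall i j t, (j + k < i)%N -> transvec i j t \in H) ->
  UTdepth k \subset H.
Proof.
move=> HE; apply/subsetP=> A.
(* The induction is on the number s of positions still to be treated, *)
(* the position (i, j) having number j * n.+1 + i. *)
suff clear_columns s :
    (forall i j, (j < i)%N -> (j * n.+1 + i + s < n.+1 * n.+1)%N ->
       GLval A i j = 0) ->
    A \in UTdepth k -> A \in H.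
  by apply: (clear_columns (n.+1 * n.+1)%N) => i j _; rewrite ltnNge leq_addl.
elim: s A => [|s IHs] A A0 UA.
  suff ->: A = 1%g by rewrite group1.
  apply: val_inj; apply/matrixP => i j; rewrite -![\val _]/(GLval _) GL_1E.
  have [lt_ji | le_ij] := ltnP j i.
    rewrite A0 //; first by rewrite mxE -val_eqE /= gtn_eqF.
    by rewrite addn0 (@leq_trans (j.+1 * n.+1)) ?leq_mul2r ?ltn_ord ?orbT //
      mulSn addnC ltn_add2r.
  by rewrite (UTdepth_entry UA) ?(leq_trans le_ij) ?leq_addr // mxE.
have [lt_s | le_s] := ltnP s (n.+1 * n.+1); last first.
  by apply: IHs => // i j _; lia.
(* The first position still to be treated is (i0, j0). *)
pose pos := (n.+1 * n.+1 - s.+1)%N.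
have pos_s : (pos + s.+1 = n.+1 * n.+1)%N by rewrite subnK.
have lt_j0 : (pos %/ n.+1 < n.+1)%N by rewrite ltn_divLR // /pos; lia.
pose j0 := Ordinal lt_j0.
pose i0 : 'I_n.+1 := Ordinal (ltn_pmod pos (ltn0Sn n)).
have posE : pos = (j0 * n.+1 + i0)%N := divn_eq pos n.+1.
have pos_uniq i j : (j * n.+1 + i)%N = pos -> i = i0 /\ j = j0.
  move=> e; split; apply: val_inj; rewrite /= -e.
    by rewrite modnMDl modn_small.
  by rewrite divnMDl // divn_small ?addn0.
have [le_i0 | lt_i0] := leqP i0 (j0 + k).
  apply: IHs => // i j lt_ji lt_pos;
    have [/pos_uniq[ei ej]|] := eqVneq (j * n.+1 + i)%N pos.
    by rewrite (UTdepth_entry UA) ?ei ?ej // -ei -ej // -val_eqE /= gtn_eqF.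
  by move=> ne_pos; apply: A0 => //; lia.
set t := transvec i0 j0 (- GLval A i0 j0).
have Ht : t \in H by apply: HE.
rewrite -(groupMr _ Ht); apply: IHs; last first.
  rewrite groupM // unip_UTdepth // depth_delta //; lia.
move=> i j lt_ji lt_pos; rewrite GL_ME transvecE;
  last exact: leq_ltn_trans (leq_addr k _) lt_i0.
rewrite mulrDr mulr1 -scalerAr !mxE (bigD1 i0) //= big1 ?addr0; last first.
  by move=> h ne_h; rewrite mxE (negPf ne_h) mulr0.
have low i' j' := @UTdepth_entry k A i' j' UA.
rewrite mxE eqxx /=; have [ej | ne_j] := eqVneq j j0; last first.
  rewrite mulr0 mulr0 addr0 A0 //.
  have : (j * n.+1 + i)%N != pos by apply: contra_neq ne_j => /pos_uniq[].
  by lia.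
have [ei | ne_i] := eqVneq i i0.
  have A1 : GLval A i0 i0 = 1 by rewrite low ?leq_addr ?eqxx.
  by rewrite ei ej A1 !mulr1 subrr.
have lt_i : (i < i0)%N.
  rewrite ltn_neqAle ne_i -(leq_add2l (j0 * n.+1)) -posE.
  by rewrite -(leq_add2r s.+1) pos_s addnS -ej.
rewrite (low i i0) ?(leq_trans (ltnW lt_i)) ?leq_addr //.
rewrite -val_eqE ltn_eqF // mul0r mulr0 addr0 A0 // ej.
by rewrite -pos_s ltn_add2r posE ltn_add2l.
Qed.

(** One inclusion is the additivity of depth under commutators; for the other,
    level k + 1 is generated by transvections, each of which is a commutator of
    a transvection of level k with one next to the diagonal. *)
Lemma lcn_UT k : 'L_k.+1(UT n.+1 F)%g = UTdepth k.
Proof.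
elim: k => [|k IHk]; first by rewrite lcn1 UT_UTdepth0.
apply/eqP; rewrite eqEsubset lcnSn IHk UT_UTdepth0 gen_subG; apply/andP; split.
  by apply/subsetP=> _ /imset2P[A B UA UB ->]; rewrite -[k]addn0 UTdepthR.
apply: transvec_gen => i j t lt_ji.
have lt_j1 : (j.+1 < n.+1)%N by apply: leq_ltn_trans (ltn_ord i); lia.
rewrite (@transvecR i j (Ordinal lt_j1)) //=; last lia.
by apply: mem_commg; rewrite unip_UTdepth // depth_delta //=; lia.
Qed.

End LowerCentralSeries.

Arguments UTdepth {n F} k.
(** * Coordinates on the quotient by the third term *)

Section Coordinates.

Local Open Scope ring_scope.

(** In the intended example [coord1] and [coord2] are the entries of the first
    two subdiagonals. Sequences indexed by nat avoid casts between ordinals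
    when passing from i to i + 1; only the indices up to r + 1 and r,
    respectively, carry information. *)
Record chain_coords (gT : finGroupType) (G : {group gT}) (F : finFieldType)
    (r : nat) := ChainCoords {
  coord1 : gT -> nat -> F;
  coord2 : gT -> nat -> F;
  of_coords : (nat -> F) -> (nat -> F) -> gT;
  coord1M : {in G &, forall x y i, (i <= r.+1)%N ->
    coord1 (x * y)%g i = coord1 x i + coord1 y i};
  coord2M : {in G &, forall x y i, (i <= r)%N ->
    coord2 (x * y)%g i = coord2 x i + coord2 y i + coord1 x i.+1 * coord1 y i};
  coord_inj : {in G &, forall x y,
    (forall i, (i <= r.+1)%N -> coord1 x i = coord1 y i) ->
    (forall i, (i <= r)%N -> coord2 x i = coord2 y i) -> x = y};
  of_coords_in : forall u v, of_coords u v \in G;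
  coord1_of_coords : forall u v i, (i <= r.+1)%N ->
    coord1 (of_coords u v) i = u i;
  coord2_of_coords : forall u v i, (i <= r)%N -> coord2 (of_coords u v) i = v i
}.

End Coordinates.

Section UTCoords.

Local Open Scope ring_scope.

Variables (r : nat) (F : finFieldType).
Local Notation GL := {'GL_r.+3[F]}.
Local Notation K := 'L_3(UT r.+3 F)%g.
Implicit Types (A B : GL).

Definition diag_entry k A (i : nat) : F := GLval A (inord (i + k)) (inord i).

Lemma subr1_offdiag (M : 'M[F]_r.+3) i j : i != j -> (M - 1) i j = M i j.
Proof. by move=> ne_ij; rewrite !mxE (negPf ne_ij) subr0. Qed.

Lemma offdiagM A B (i j : 'I_r.+3) : i != j ->
  GLval (A * B)%g i j =
    ((GLval A - 1) * (GLval B - 1)) i j + GLval A i j + GLval B i j.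
Proof.
move=> ne_ij; rewrite -subr1_offdiag // GL_ME subr1M.
by rewrite [LHS]mxE [X in X + _ = _]mxE !subr1_offdiag.
Qed.

Lemma diag_entry1M A B i : A \in UTdepth 0 -> B \in UTdepth 0 ->
  (i <= r.+1)%N ->
  diag_entry 1 (A * B)%g i = diag_entry 1 A i + diag_entry 1 B i.
Proof.
rewrite !inE => dA dB le_i; rewrite /diag_entry offdiagM; last first.
  by rewrite -val_eqE /= !inordK; lia.
have /depthP -> := depthM dA dB; first by rewrite add0r.
by rewrite !inordK; lia.
Qed.

(** In the product of the nilpotent parts, only the path from i to i + 2 through
    i + 1 contributes to the second subdiagonal. *)
Lemma diag_entry2M A B i : A \in UTdepth 0 -> B \in UTdepth 0 -> (i <= r)%N ->
  diag_entry 2 (A * B)%g i =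
    diag_entry 2 A i + diag_entry 2 B i
    + diag_entry 1 A i.+1 * diag_entry 1 B i.
Proof.
rewrite !inE => dA dB le_i; rewrite /diag_entry offdiagM; last first.
  by rewrite -val_eqE /= !inordK; lia.
rewrite -addrA addrC; congr (_ + _).
rewrite mxE (bigD1 (inord i.+1)) //= big1 => [|h ne_h].
  rewrite addr0 !addn1 !addn2; congr (_ * _).
    by rewrite subr1_offdiag //; rewrite -val_eqE /= !inordK; lia.
  by rewrite subr1_offdiag //; rewrite -val_eqE /= !inordK; lia.
have [le_h | lt_h] := leqP h i.
  by move/depthP: dB => ->; rewrite ?mulr0 // inordK; lia.
move/depthP: dA => ->; rewrite ?mul0r // inordK; last lia.
by have : (h != i.+1 :> nat); [move: ne_h; rewrite -val_eqE /= inordK;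
  lia | lia].
Qed.

Lemma UTdepth2P A : A \in UTdepth 0 ->
    (forall i, (i <= r.+1)%N -> diag_entry 1 A i = 0) ->
    (forall i, (i <= r)%N -> diag_entry 2 A i = 0) ->
  A \in UTdepth 2.
Proof.
rewrite !inE => /depthP dA a1 a2; apply/depthP=> i j lt_ij.
have [lt_i1 | le_j] := ltnP i (j + 1); first exact: dA.
have lt_i := ltn_ord i.
rewrite subr1_offdiag; last by rewrite -val_eqE /=; lia.
have iE d : i = (j + d)%N :> nat -> GLval A i j = diag_entry d A j.
  by move=> e; rewrite /diag_entry -e !inord_val.
have [e|e] : i = (j + 1)%N :> nat \/ i = (j + 2)%N :> nat by lia.
  by rewrite (iE 1%N) // a1 //; lia.
by rewrite (iE 2%N) // a2 //; lia.
Qed.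

Lemma UTmodL3P x : x \in UTmodL3 r.+3 F ->
  exists2 A, A \in UTdepth 0 & x = coset K A.
Proof. by case/morphimP=> A _ UA ->; exists A; rewrite // -UT_UTdepth0. Qed.

Lemma UT_norm A : A \in UTdepth 0 -> A \in 'N(K)%g.
Proof. by rewrite -UT_UTdepth0;
  apply: (subsetP (lcn_norm 3 (UT_group r.+3 F))). Qed.

(** The first two subdiagonals are constant on cosets, because those of the
    elements of 'L_3 vanish. *)
Lemma diag_entry_repr k A i : A \in UTdepth 0 -> (0 < k <= 2)%N ->
  (i + k <= r.+2)%N ->
  diag_entry k (repr (coset K A)) i = diag_entry k A i.
Proof.
move=> UA; have /rcosetP[Z + ->] : repr (coset K A) \in (K :* A)%g.
  have <-: coset K A = (K :* A)%g :> {set GL} by apply: val_coset (UT_norm UA).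
  exact: mem_repr_coset.
rewrite lcn_UT => UZ.
have Z0 d j : (0 < d <= 2)%N -> (j + d <= r.+2)%N -> diag_entry d Z j = 0.
  move=> d2 le_j; rewrite /diag_entry (UTdepth_entry UZ) ?inordK; try lia.
  by rewrite -val_eqE /= !inordK ?gtn_eqF //; lia.
have UZ0 := UTdepthW (leq0n 2) UZ.
case: k => [|[|[|k]]] // _ le_i.
  by rewrite diag_entry1M ?Z0 ?add0r //; lia.
by rewrite diag_entry2M ?(Z0 2%N) ?(Z0 1%N) ?add0r ?mul0r ?addr0 //; lia.
Qed.

Definition quo_entry k (x : coset_of K) i : F := diag_entry k (repr x) i.

Definition two_diag (u v : nat -> F) : 'M[F]_r.+3 :=
  \matrix_(i, j) (if i == j.+1 :> nat then u j else if i == j.+2 :> nat then v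
    j else 0).

Lemma two_diag_depth u v : depth 1 (two_diag u v).
Proof.
apply/depthP=> i j; rewrite addn1 ltnS mxE => le_ij.
by rewrite !ltn_eqF // ltnS ltnW.
Qed.

Lemma diag_entry1_unip u v i : (i <= r.+1)%N ->
  diag_entry 1 (unip (two_diag u v)) i = u i.
Proof.
move=> le_i; rewrite /diag_entry unipE ?two_diag_depth //
  !mxE -val_eqE /= !inordK; try lia.
by rewrite addn1 eqxx gtn_eqF // add0r.
Qed.

Lemma diag_entry2_unip u v i : (i <= r)%N ->
  diag_entry 2 (unip (two_diag u v)) i = v i.
Proof.
move=> le_i; rewrite /diag_entry unipE ?two_diag_depth //
  !mxE -val_eqE /= !inordK; try lia.
by rewrite addn2 eqxx !gtn_eqF // add0r.
Qed.

Lemma UTmodL3_coords : chain_coords (UTmodL3_group r.+3 F) F r.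
Proof.
pose of_coords u v := coset K (unip (two_diag u v)).
have Uuv u v : unip (two_diag u v) \in UTdepth 0 by rewrite unip_UTdepth ?
  two_diag_depth.
have entryE k A i : A \in UTdepth 0 -> (0 < k <= 2)%N -> (i + k <= r.+2)%N ->
    quo_entry k (coset K A) i = diag_entry k A i by apply: diag_entry_repr.
have le1 i : (i <= r.+1)%N -> (i + 1 <= r.+2)%N by rewrite addn1.
have le2 i : (i <= r)%N -> (i + 2 <= r.+2)%N by rewrite addn2.
exists (quo_entry 1) (quo_entry 2) of_coords.
- move=> _ _ /UTmodL3P[A UA ->] /UTmodL3P[B UB ->] i le_i.
  by rewrite -morphM ?UT_norm //= !entryE ?groupM ?le1 // diag_entry1M.
- move=> _ _ /UTmodL3P[A UA ->] /UTmodL3P[B UB ->] i le_i.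
  by rewrite -morphM ?UT_norm //= !entryE ?groupM ?le1 ?le2 ?(leqW le_i) //
    diag_entry2M.
- move=> _ _ /UTmodL3P[A UA ->] /UTmodL3P[B UB ->] eq1 eq2.
  have UZ : (A * B^-1)%g \in UTdepth 0 by rewrite groupM ?groupV.
  have AE : A = (A * B^-1 * B)%g by rewrite mulgKV.
  have Z1 i : (i <= r.+1)%N -> diag_entry 1 (A * B^-1)%g i = 0.
    move=> le_i; have := eq1 i le_i;
      rewrite !entryE ?le1 // {1}AE diag_entry1M //.
    by move=> e; apply: (addIr (diag_entry 1 B i)); rewrite e add0r.
  have Z2 i : (i <= r)%N -> diag_entry 2 (A * B^-1)%g i = 0.
    move=> le_i; have := eq2 i le_i;
      rewrite !entryE ?le2 // {1}AE diag_entry2M //.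
    by rewrite Z1 // mul0r addr0 => e; apply: (addIr (diag_entry 2 B i));
      rewrite e add0r.
  have KZ : (A * B^-1)%g \in K by rewrite lcn_UT UTdepth2P.
  by rewrite AE coset_kerl.
- by move=> u v; apply: mem_quotient; have := Uuv u v; rewrite -UT_UTdepth0.
- by move=> u v i le_i; rewrite entryE ?le1 // diag_entry1_unip.
by move=> u v i le_i; rewrite entryE ?le2 // diag_entry2_unip.
Qed.

End UTCoords.

(** * Counting the additive self-maps of a finite field *)

Section AdditiveMaps.

Local Open Scope ring_scope.

Definition additive_maps (F : finFieldType) : {set {ffun F -> F}} :=
  [set f : {ffun F -> F} | [forall x, forall y, f (x + y) == f x + f y]].

Lemma additive_mapsP (F : finFieldType) (f : {ffun F -> F}) :
  reflect {morph f : x y / x + y} (f \in additive_maps F).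
Proof.
rewrite inE; apply: (iffP forallP) => [fD x y | fD x].
  exact/eqP/(forallP (fD x)).
by apply/forallP => y; rewrite fD.
Qed.

Lemma morphD0 (U V : zmodType) (f : U -> V) : {morph f : x y / x + y} ->
  f 0 = 0.
Proof. by move=> fD; apply: (addrI (f 0)); rewrite -fD !addr0. Qed.

(** Additive maps over a prime field are linear, since every scalar is the image
    of a natural number. *)
Lemma additive_rV_mulmx (p m k : nat) (g : 'rV['F_p]_m -> 'rV['F_p]_k) :
    {morph g : u v / u + v} ->
  forall u, g u = u *m (\matrix_i g (delta_mx 0 i)).
Proof.
move=> gD u; have g0 := morphD0 gD.
have gZ (c : 'F_p) v : g (c *: v) = c *: g v.
  rewrite -(natr_Zp c) !scaler_nat.
  by elim: (nat_of_ord c) => [|i IHi]; rewrite ?mulr0n // !mulrS gD IHi.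
rewrite {1}[u]row_sum_delta (big_morph _ gD g0) mulmx_sum_row.
by apply: eq_bigr => i _; rewrite gZ rowK.
Qed.

(** F is an m-dimensional space over its prime field, so additive self-maps
    correspond to m by m matrices. *)
Lemma card_additive_maps (F : finFieldType) (p m : nat) :
  prime p -> #|F| = (p ^ m)%N -> #|additive_maps F| = (p ^ (m * m))%N.
Proof.
move=> p_pr oF; have pcharF := card_finPcharP oF p_pr.
have [v [w [vD vK wK]]] : exists v : F -> 'rV['F_p]_m, exists w,
    [/\ {morph v : x y / x + y}, cancel v w & cancel w v].
  have := pprimeChar_vectAxiom pcharF; rewrite oF pfactorK //.
  case=> v vL [w vK wK]; exists v, w; split=> // x y.
  by have := vL 1 x y; rewrite !scale1r.
have wD: {morph w : x y / x + y}.
  by move=> x y; apply: (can_inj vK); rewrite vD !wK.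
pose f (A : 'M['F_p]_m) := [ffun x => w (v x *m A)].
have f_inj: injective f.
  move=> A B /ffunP eqAB; apply/row_matrixP => i.
  have := eqAB (w (delta_mx 0 i)); rewrite !ffunE wK => /(can_inj wK).
  by rewrite -!rowE.
have <-: f @: [set: 'M['F_p]_m] = additive_maps F.
  apply/setP => g; apply/imsetP/additive_mapsP => [[A _ ->] x y | gD].
    by rewrite !ffunE vD mulmxDl wD.
  exists (\matrix_i v (g (w (delta_mx 0 i)))); first by rewrite inE.
  apply/ffunP => x; rewrite ffunE.
  rewrite -(additive_rV_mulmx (g := fun u => v (g (w u)))) ?vK //.
  by move=> u1 u2; rewrite wD gD vD.
by rewrite card_imset // cardsT card_mx card_Fp.
Qed.

End AdditiveMaps.

(** * Class preserving automorphisms in coordinates *)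

Section ChainCoords.

Local Open Scope ring_scope.

Variables (gT : finGroupType) (G : {group gT}) (F : finFieldType) (r : nat).
Variable C : chain_coords G F r.
Local Notation a := (coord1 C).
Local Notation b := (coord2 C).
Implicit Types (x y : gT) (u v : nat -> F) (i j : nat).

Lemma coord1J x y i : x \in G -> y \in G -> (i <= r.+1)%N ->
  a (x ^ y)%g i = a x i.
Proof.
move=> Gx Gy le_i; apply: (addrI (a y i)).
by rewrite -(coord1M C) ?groupJ // -conjgC (coord1M C) // addrC.
Qed.

Lemma coord2J x y i : x \in G -> y \in G -> (i <= r)%N ->
  b (x ^ y)%g i = b x i + (a x i.+1 * a y i - a y i.+1 * a x i).
Proof.
move=> Gx Gy le_i; have := coord2M C Gy (groupJ Gx Gy) le_i.
rewrite -conjgC (coord2M C) // coord1J ?(leqW le_i) // => e.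
by apply: (addrI (b y i)); apply: (addIr (a y i.+1 * a x i)); rewrite -e; ring.
Qed.

(** The converse of [coord1J] and [coord2J]: the conjugacy class of x consists
    of all elements whose coordinates have the form found there. *)
Lemma conjg_of_coords x y u : x \in G -> y \in G ->
    (forall i, (i <= r.+1)%N -> a y i = a x i) ->
    (forall i, (i <= r)%N ->
      b y i = b x i + (a x i.+1 * u i - u i.+1 * a x i)) ->
  y = (x ^ of_coords C u (fun=> 0))%g.
Proof.
move=> Gx Gy eq_a eq_b; apply: (coord_inj (c := C));
  rewrite ?groupJ ?of_coords_in // => i le_i.
  by rewrite coord1J ?of_coords_in ?eq_a.
by rewrite coord2J ?of_coords_in ?eq_b ?coord1_of_coords // leqW.
Qed.

(** Equivalently, the center of G is the set where all first coordinates vanish;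
    the elements with a single nonzero first coordinate, equal to 1, detect the
    coordinates of a conjugating element one at a time. *)
Lemma conj_aut_eq x y : x \in G -> y \in G ->
  (conj_aut G x == conj_aut G y) = [forall i : 'I_r.+2, a x i == a y i].
Proof.
move=> Gx Gy; apply/eqP/forallP => [eq_xy i | eq_a].
  pose e j := of_coords C (fun h => (h == j)%:R) (fun=> 0).
  have eJ j h : (h <= r)%N -> a (e j) h.+1 * a x h - a x h.+1 * a (e j) h
                 = a (e j) h.+1 * a y h - a y h.+1 * a (e j) h.
    move=> le_h; apply: (addrI (b (e j) h)); rewrite -!coord2J ?of_coords_in //.
    by rewrite -!(conj_autE _ (of_coords_in C _ _)) // eq_xy.
  case: i => [[|j] lt_j] /=.
    have := eJ 1%N 0%N isT; rewrite !coord1_of_coords //= !mulr0 !subr0 !mul1r.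
    by move->.
  have := eJ j j lt_j; rewrite !coord1_of_coords ?(leqW (_ : j <= r)%N) //.
  by rewrite eqxx gtn_eqF // !mul0r !sub0r !mulr1 => /oppr_inj ->.
have eq_a' i : (i <= r.+1)%N -> a x i = a y i.
  by rewrite -ltnS => lt_i; apply/eqP/(eq_a (Ordinal lt_i)).
apply: (eq_Aut (A := G)); rewrite ?Aut_aut // => z Gz.
rewrite !conj_autE //; apply: (coord_inj (c := C));
  rewrite ?groupJ // => i le_i.
  by rewrite !coord1J.
by rewrite !coord2J // !eq_a' // leqW.
Qed.

Lemma card_Inn : #|Inn G| = (#|F| ^ r.+2)%N.
Proof.
pose e (u : {ffun 'I_r.+2 -> F}) := of_coords C (fun i =>
  u (inord i)) (fun=> 0).
have ae (u : {ffun 'I_r.+2 ->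
  F}) (i : 'I_r.+2) : a (e u) i =
  u i by rewrite coord1_of_coords ?inord_val // -ltnS.
have <-: (conj_aut G \o e) @: [set: {ffun 'I_r.+2 -> F}] = Inn G.
  apply/setP=> f; apply/imsetP/morphimP => [[u _ ->] | [x _ Gx ->]].
    by exists (e u); rewrite ?(subsetP (normG G)) ?of_coords_in.
  exists [ffun i : 'I_r.+2 => a x i]; rewrite ?inE //=; apply/eqP.
  by rewrite conj_aut_eq ?of_coords_in //; apply/forallP=> i; rewrite ae ffunE.
rewrite card_imset ?cardsT ?card_ffun ?card_ord // => u v /eqP.
rewrite conj_aut_eq ?of_coords_in // => /forallP eq_uv; apply/ffunP => i.
by rewrite -!ae; apply/eqP.
Qed.

Definition shift (f : {perm gT}) x i : F := b (f x) i - b x i.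

Lemma Aut_cP (f : {perm gT}) x : f \in Aut_c G -> x \in G ->
  exists2 g, g \in G & f x = (x ^ g)%g.
Proof.
rewrite inE => /andP[_ /forall_inP fc] Gx.
by have /imsetP[g Gg ->] := fc x Gx; exists g.
Qed.

Lemma Aut_c_closed (f : {perm gT}) x : f \in Aut_c G -> x \in G -> f x \in G.
Proof. by rewrite inE => /andP[Af _] Gx; rewrite (Aut_closed Af). Qed.

Lemma Aut_cM (f : {perm gT}) : f \in Aut_c G ->
  {in G &, {morph f : x y / (x * y)%g}}.
Proof. by rewrite inE => /andP[Af _] x y Gx Gy; rewrite -(autmE Af) morphM. Qed.

Lemma coord1_Aut_c (f : {perm gT}) x i : f \in Aut_c G -> x \in G ->
  (i <= r.+1)%N ->
  a (f x) i = a x i.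
Proof. by move=> Cf Gx le_i; have [g Gg ->] := Aut_cP Cf Gx;
  rewrite coord1J. Qed.

Lemma shift_conj (f : {perm gT}) x : f \in Aut_c G -> x \in G ->
  exists u, forall i, (i <= r)%N ->
  shift f x i = a x i.+1 * u i - u i.+1 * a x i.
Proof.
move=> Cf Gx; have [g Gg fx] := Aut_cP Cf Gx; exists (a g) => i le_i.
by rewrite /shift fx coord2J // addrC addKr.
Qed.

Lemma shiftM (f : {perm gT}) x y i : f \in Aut_c G -> x \in G -> y \in G ->
  (i <= r)%N ->
  shift f (x * y)%g i = shift f x i + shift f y i.
Proof.
move=> Cf Gx Gy le_i; rewrite /shift Aut_cM // !(coord2M C) ?Aut_c_closed //.
by rewrite !coord1_Aut_c ?(leqW le_i) //; ring.
Qed.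

(** Additivity reduces the claim to x y^-1, whose first coordinates vanish at i
    and i + 1; the formula of [shift_conj] then gives 0 whatever the conjugating
    element is. *)
Lemma shift_local (f : {perm gT}) x y i : f \in Aut_c G -> x \in G ->
  y \in G -> (i <= r)%N ->
  a x i = a y i -> a x i.+1 = a y i.+1 -> shift f x i = shift f y i.
Proof.
move=> Cf Gx Gy le_i eq_i eq_i1; pose z := (x * y^-1)%g.
have Gz : z \in G by rewrite groupM ?groupV.
have xE : x = (z * y)%g by rewrite mulgKV.
have az j : (j <= r.+1)%N -> a x j = a y j -> a z j = 0.
  by move=> le_j e; apply: (addIr (a y j)); rewrite add0r -(coord1M C) // -xE.
have [u fz] := shift_conj Cf Gz.
by rewrite xE shiftM // fz // !az ?(leqW le_i) // mul0r mulr0 subrr add0r.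
Qed.

(** The shift of g depends on first coordinates only, and f preserves these. *)
Lemma shift_comp (f g : {perm gT}) x i : f \in Aut_c G -> g \in Aut_c G ->
  x \in G -> (i <= r)%N ->
  shift (f * g)%g x i = shift f x i + shift g x i.
Proof.
move=> Cf Cg Gx le_i.
rewrite -(@shift_local g (f x)) ?Aut_c_closed ?coord1_Aut_c ?(leqW le_i) //.
by rewrite /shift permM [RHS]addrC subrKA.
Qed.

Lemma shift_inj (f g : {perm gT}) : f \in Aut_c G -> g \in Aut_c G ->
  (forall x i, x \in G -> (i <= r)%N -> shift f x i = shift g x i) -> f = g.
Proof.
move=> Cf Cg eq_fg; have Af h : h \in Aut_c G ->
  h \in Aut G by rewrite inE => /andP[].
apply: (eq_Aut (Af f Cf) (Af g Cg)) => x Gx.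
apply: (coord_inj (c := C)); rewrite ?Aut_c_closed // => i le_i.
  by rewrite !coord1_Aut_c.
by apply: (addIr (- b x i)); apply: eq_fg.
Qed.

(** By [shift_comp] and [shift_inj], the group embeds into the additive group of
    functions with values in F. *)
Lemma Aut_c_abelem p : p \in [pchar F] -> (p.-abelem (Aut_c G))%g.
Proof.
move=> pcharF; have p_pr := pcharf_prime pcharF.
rewrite abelemE //; apply/andP; split.
  apply/centsP=> f Cf g Cg; apply: shift_inj; rewrite ?groupM // => x i Gx le_i.
  by rewrite !shift_comp // addrC.
apply/exponentP=> f Cf; apply: shift_inj;
  rewrite ?groupX ?group1 // => x i Gx le_i.
have fX k : shift (f ^+ k)%g x i = shift f x i *+ k.
  elim: k => [|k IHk]; first by rewrite expg0 /shift perm1 subrr.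
  by rewrite expgS shift_comp ?groupX // IHk mulrS.
by rewrite fX /shift perm1 subrr mulrn_pchar.
Qed.

(** Adding to the second coordinates an additive function of the first ones is
    an automorphism, as the elements with zero first coordinates are central.
    It is class preserving as soon as the added function is pointwise a
    commutator. *)
Lemma Aut_c_of_shift (L R : nat -> F -> F) :
    (forall i, {morph L i : s t / s + t}) ->
      (forall i, {morph R i : s t / s + t}) ->
    (forall x, x \in G -> exists u, forall i, (i <= r)%N ->
       L i (a x i.+1) + R i (a x i) = a x i.+1 * u i - u i.+1 * a x i) ->
  exists2 f, f \in Aut_c G & forall x i, x \in G -> (i <= r)%N ->
    shift f x i = L i (a x i.+1) + R i (a x i).
Proof.
move=> LD RD LRc.
(* Hiding the body of h keeps the product rules from unfolding h x. *)
have [h hE] : {h | forall x, h x =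
    (x * of_coords C (fun=> 0) (fun i => L i (a x i.+1) + R i (a x i)))%g}.
  by eexists=> x; reflexivity.
have Gh x : x \in G -> h x \in G by move=> Gx; rewrite hE groupM ?of_coords_in.
have ah x i : x \in G -> (i <= r.+1)%N -> a (h x) i = a x i.
  by move=> Gx le_i; rewrite hE (coord1M C) ?of_coords_in //
    coord1_of_coords // addr0.
have bh x i : x \in G -> (i <= r)%N ->
  b (h x) i = b x i + (L i (a x i.+1) + R i (a x i)).
  by move=> Gx le_i; rewrite hE (coord2M C) ?of_coords_in //
    coord2_of_coords // coord1_of_coords ?(leqW le_i) // mulr0 addr0.
have hM : {in G &, {morph h : x y / (x * y)%g}}.
  move=> x y Gx Gy; apply: (coord_inj (c := C));
    rewrite ?groupM ?Gh ?groupM // => i le_i.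
    by rewrite ah ?groupM // !(coord1M C) ?Gh // !ah.
  have le_i1 := leqW le_i.
  rewrite bh ?groupM // !(coord2M C) ?Gh // !bh // !ah // !(coord1M C) // LD RD.
  by ring.
pose hm := Morphism hM.
have hm_inj : ('injm hm)%g.
  apply/injmP=> x y Gx Gy eq_h; apply: (coord_inj (c := C)) => // i le_i.
    by rewrite -(ah x) // -(ah y) //; congr (a _ i).
  have eq_a j : (j <= r.+1)%N -> a x j = a y j.
    by move=> le_j; rewrite -(ah x) // -(ah y) //; congr (a _ j).
  apply: (addIr (L i (a x i.+1) + R i (a x i))).
  rewrite -(bh x) // !eq_a ?(leqW le_i) // -(bh y) //; congr (b _ i);
    exact: eq_h.
have hmG : (hm @* G = G)%g.
  apply/eqP; rewrite eqEcard card_injm // leqnn andbT.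
  by apply/subsetP=> _ /morphimP[x _ Gx ->]; apply: Gh.
have fE x : x \in G -> aut hm_inj hmG x = h x by move=> Gx; rewrite autE.
exists (aut hm_inj hmG) => [|x i Gx le_i];
  last by rewrite /shift fE // bh // addrC addKr.
rewrite inE Aut_aut; apply/forall_inP=> x Gx; rewrite fE //.
have [u uE] := LRc x Gx;
  rewrite (@conjg_of_coords x (h x) u) ?Gh ?memJ_class ?of_coords_in // =>
  i le_i.
  by rewrite ah.
by rewrite bh // uE.
Qed.

Definition axis_elt j (t : F) : gT := of_coords C (fun h =>
  if h == j then t else 0) (fun=> 0).
Definition shiftR (f : {perm gT}) i (t : F) : F := shift f (axis_elt i t) i.
Definition shiftL (f : {perm gT}) i (t : F) : F := shift f (axis_elt i.+1 t) i.

Lemma axis_elt_in j t : axis_elt j t \in G. Proof. exact: of_coords_in. Qed.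

Lemma coord1_axis_elt j t i : (i <= r.+1)%N ->
  a (axis_elt j t) i = if i == j then t else 0.
Proof. exact: coord1_of_coords. Qed.

(** By [shift_local], x may be replaced by an element whose first coordinates
    agree with those of x at i and i + 1 and vanish elsewhere. *)
Lemma shift_split (f : {perm gT}) x i : f \in Aut_c G -> x \in G ->
  (i <= r)%N ->
  shift f x i = shiftL f i (a x i.+1) + shiftR f i (a x i).
Proof.
move=> Cf Gx le_i; rewrite -shiftM ?axis_elt_in //.
apply: shift_local; rewrite ?groupM ?axis_elt_in //
  (coord1M C) ?axis_elt_in ?(leqW le_i) //.
  by rewrite !coord1_axis_elt ?(leqW le_i) // ltn_eqF // eqxx add0r.
by rewrite !coord1_axis_elt // eqxx gtn_eqF // addr0.
Qed.

Lemma shift_axis_eltD (f : {perm gT}) i j : f \in Aut_c G -> (i <= r)%N ->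
  {morph (fun t => shift f (axis_elt j t) i) : s t / s + t}.
Proof.
move=> Cf le_i s t; rewrite -shiftM ?axis_elt_in //.
have aD h : (h <= r.+1)%N ->
  a (axis_elt j (s + t)) h = a (axis_elt j s * axis_elt j t)%g h.
  move=> le_h; rewrite (coord1M C) ?axis_elt_in // !coord1_axis_elt //.
  by case: ifP; rewrite ?addr0.
by apply: shift_local; rewrite ?groupM ?axis_elt_in // aD // leqW.
Qed.

(** For x with first coordinates s at i, 0 at i + 1 and t at i + 2, the shifts
    at i and i + 1 are - u s and t u, for one and the same coordinate u of the
    element conjugating x to f x. *)
Lemma shift_rigid (f : {perm gT}) i s t : f \in Aut_c G -> (i < r)%N ->
  t * shiftR f i s + s * shiftL f i.+1 t = 0.
Proof.
move=> Cf lt_i; pose x := (axis_elt i s * axis_elt i.+2 t)%g.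
have Gx : x \in G by rewrite groupM ?axis_elt_in.
have lei := ltnW lt_i.
have ax j : (j <= r.+1)%N ->
  a x j = (if j == i then s else 0) + (if j == i.+2 then t else 0).
  by move=> le_j; rewrite (coord1M C) ?axis_elt_in // !coord1_axis_elt.
have a0 : a x i = s by rewrite ax ?(leqW lei) // eqxx ltn_eqF ?addr0 // ltnW.
have a1 : a x i.+1 = 0 by rewrite ax // gtn_eqF // ltn_eqF // addr0.
have a2 : a x i.+2 = t by rewrite ax // eqxx gtn_eqF ?add0r // ltnW.
have L0 : shiftL f i 0 = 0 := morphD0 (shift_axis_eltD i.+1 Cf lei).
have R0 : shiftR f i.+1 0 = 0 := morphD0 (shift_axis_eltD i.+1 Cf lt_i).
have [u ux] := shift_conj Cf Gx.
have := ux i lei; have := ux i.+1 lt_i.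
rewrite !shift_split //
  a0 a1 a2 L0 R0 add0r addr0 mul0r mulr0 subr0 sub0r => -> ->.
by ring.
Qed.

Lemma shiftR_linear (f : {perm gT}) i t : f \in Aut_c G -> (i < r)%N ->
  shiftR f i t = t * shiftR f i 1.
Proof.
move=> Cf lt_i; have := shift_rigid 1 1 Cf lt_i;
  have := shift_rigid t 1 Cf lt_i.
rewrite !mul1r => /eqP; rewrite addr_eq0 => /eqP-> /eqP;
  rewrite addrC addr_eq0 => /eqP->.
by rewrite mulrN opprK.
Qed.

Lemma shiftL_linear (f : {perm gT}) i t : f \in Aut_c G -> (i < r)%N ->
  shiftL f i.+1 t = - (shiftR f i 1 * t).
Proof.
move=> Cf lt_i; have := shift_rigid 1 t Cf lt_i.
by rewrite mul1r addrC mulrC => /eqP; rewrite addr_eq0 => /eqP.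
Qed.

(** By [shiftR_linear] and [shiftL_linear], the scalars in the third component
    are the ones that govern all the inner left and right parts. *)
Definition shift_data (f : {perm gT}) :=
  ([ffun t => shiftL f 0 t], [ffun t => shiftR f r t],
   [ffun i : 'I_r => shiftR f i 1]).

Lemma shift_data_inj : {in Aut_c G &, injective shift_data}.
Proof.
move=> f g Cf Cg [/ffunP eqL /ffunP eqR /ffunP eqK].
have eqk i : (i < r)%N -> shiftR f i 1 = shiftR g i 1.
  by move=> lt_i; have := eqK (Ordinal lt_i); rewrite !ffunE.
apply: shift_inj => // x i Gx le_i; rewrite !shift_split //; congr (_ + _).
  case: i le_i => [_|i lt_i]; first by have := eqL (a x 1); rewrite !ffunE.
  by rewrite !shiftL_linear // eqk.
move: le_i; rewrite leq_eqVlt => /orP[/eqP->|lt_i].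
  by have := eqR (a x r); rewrite !ffunE.
by rewrite shiftR_linear // eqk // -shiftR_linear.
Qed.

(** The conjugating element depends on x: division by a_1(x) and a_r(x) lets its
    two end coordinates realize L and R, whereas its inner coordinates are the
    scalars - k. *)
Lemma shift_data_surj (L R : {ffun F -> F}) (k : {ffun 'I_r -> F}) :
    L \in additive_maps F -> R \in additive_maps F ->
  exists2 f, f \in Aut_c G & shift_data f = (L, R, k).
Proof.
move=> /additive_mapsP LD /additive_mapsP RD.
have L0 := morphD0 LD; have R0 := morphD0 RD.
pose kk i := oapp k 0 (insub i).
pose LL i t := if i is j.+1 then - (kk j * t) else L t.
pose RR i t := if i == r then R t else kk i * t.
have LLD i : {morph LL i : s t / s + t}.
  by case: i => [|i] s t /=; rewrite ?LD // mulrDr opprD.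
have RRD i : {morph RR i : s t / s + t}.
  by move=> s t; rewrite /RR; case: eqP => _; rewrite ?RD // mulrDr.
have [x Gx | f Cf fE] := Aut_c_of_shift LLD RRD.
  pose u i := if i is j.+1 then if j == r then - (R (a x r) / a x r) else - kk j
              else L (a x 1%N) / a x 1%N.
  (* Division by zero is harmless, as additive maps vanish at 0. *)
  have divK (g : F -> F) t : g 0 = 0 -> g t / t * t = g t.
    by move=> g0; have [->|t_neq0] := eqVneq t 0; rewrite ?mulr0 ?divfK.
  exists u => i le_i; congr (_ + _).
    case: i le_i => [_|i lt_i] /=; first by rewrite mulrC divK.
    by rewrite ltn_eqF // mulrN mulrC.
  rewrite /RR /=; case: eqP => [->|_]; first by rewrite mulNr opprK divK.
  by rewrite mulNr opprK.
exists f => //; congr (_, _, _); apply/ffunP=> t; rewrite ffunE.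
- rewrite /shiftL fE ?axis_elt_in // !coord1_axis_elt //= /RR.
  by case: eqP => _; rewrite ?R0 ?mulr0 addr0.
- rewrite /shiftR fE ?axis_elt_in // !coord1_axis_elt //= /RR eqxx gtn_eqF //.
  by case: (r) => [|?] /=; rewrite ?L0 ?mulr0 ?oppr0 add0r.
have lt_t := ltn_ord t.
rewrite /shiftR fE ?axis_elt_in ?(ltnW lt_t) //
  !coord1_axis_elt ?(leqW (ltnW lt_t)) //; last exact: leqW.
rewrite /RR eqxx gtn_eqF // ltn_eqF // /kk valK mulr1 /LL.
by case: (val t) => [|?] /=; rewrite ?L0 ?mulr0 ?oppr0 add0r.
Qed.

Lemma card_Aut_c : #|Aut_c G| = (#|additive_maps F| ^ 2 * #|F| ^ r)%N.
Proof.
rewrite -(card_in_imset shift_data_inj).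
have ->: shift_data @: Aut_c G =
    setX (setX (additive_maps F) (additive_maps F)) [set: {ffun 'I_r -> F}].
  apply/setP=> -[[L R] k]; rewrite !in_setX in_setT andbT.
  apply/imsetP/andP=> [[f Cf [-> -> _]] | [LD RD]].
    split; apply/additive_mapsP=> s t; rewrite !ffunE.
      exact: (shift_axis_eltD 1 Cf (leq0n r)).
    exact: (shift_axis_eltD r Cf (leqnn r)).
  by have [f Cf <-] := shift_data_surj k LD RD; exists f.
by rewrite !cardsX cardsT card_ffun card_ord mulnn.
Qed.

End ChainCoords.

Lemma Aut_c_chain (gT : finGroupType) (G : {group gT}) (F : finFieldType)
  (r m p : nat) :
    chain_coords G F r -> prime p -> #|F| = (p ^ m)%N ->
  [/\ (p.-abelem (Aut_c G))%g, #|Aut_c G| = (p ^ (2 * m ^ 2 + m * r))%N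
    & #|Out_c G| = (p ^ (2 * m * (m - 1)))%N].
Proof.
move=> C p_pr oF.
have oAut : #|Aut_c G| = (p ^ (2 * m ^ 2 + m * r))%N.
  rewrite (card_Aut_c C) (card_additive_maps p_pr oF) oF -!expnM -expnD.
  by congr (p ^ (_ + _))%N; rewrite mulnC.
split=> //; first exact: (Aut_c_abelem C (card_finPcharP oF p_pr)).
rewrite /Out_c card_quotient ?normal_norm ?Inn_normal //
  -divgS ?normal_sub ?Inn_normal //.
have le_m : (m * r.+2 <= 2 * m ^ 2 + m * r)%N.
  by case: m {oF oAut} => // m; rewrite mulnSr mulnSr -addnA addnC leq_add2r;
    nia.
rewrite oAut (card_Inn C) oF -expnM -expnB ?prime_gt0 //; congr (p ^ _)%N.
by nia.
Qed.

Theorem theoremB (n m p : nat) (F : finFieldType)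
    (n_ge3 : 3 <= n) (m_ge1 : 1 <= m) (p_prime : prime p)
    (cardF : #|F| = p ^ m) :
  ((p.-abelem (Aut_c (UTmodL3_group n F)))%g /\
    #|Aut_c (UTmodL3_group n F)| = p ^ (2 * m ^ 2 + m * n - 3 * m)) /\
  #|Out_c (UTmodL3_group n F)| = p ^ (2 * m * (m - 1)).
Proof.
case: n n_ge3 => [|[|[|r]]] // _.
have [-> -> ->] := Aut_c_chain (UTmodL3_coords r F) p_prime cardF.
do 2!split=> //; congr (p ^ _); lia.
Qed.
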